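(* The homeomorphisms $\mathbf J_{\partial\mathcal F}$ and $S$ of $\partial_I\mathcal F$ satisfy $\mathbf J_{\partial\mathcal F}S=V\mathbf J_{\partial\mathcal F}$. Hence for every irrational real $x$ one has $\mathbf J_{\mathbb R}(-1/x)=-\mathbf J_{\mathbb R}(x)$ in $\widehat{\mathbb R}$.
   Context: $\mathrm{PSL}_2(\mathbb Z)=\langle S,L\mid S^2=L^3=1\rangle$, $S(z)=-1/z$, $L(z)=(z-1)/z$. The bipartite Farey tree $\mathcal F$ has edge set $\mathrm{PSL}_2(\mathbb Z)$ and vertices the left cosets $\{W,WS\}$, $\{W,WL,WL^2\}$, two distinct vertices being joined by an edge iff they intersect. $\partial_I\mathcal F$ is the set of infinite non-backtracking paths in $\mathcal F$ starting at the identity edge $I$, i.e. infinite reduced words in $S,L,L^2$, with topology generated by the sets of paths through a given edge. Writing $0$ for $LS$ and $1$ for $L^2S$, these are the words $a$ or $Sa$ with $a\in\{0,1\}^\omega$. The action of $S$ on $\partial_I\mathcal F$ by left multiplication is $S(a)=Sa$, $S(Sa)=a$. The map $U$ on $\partial_I\mathcal F$ is $U(a)=\lnot a$, $U(Sa)=S\lnot a$ (term-wise negation), and $V=SU=US$. With $\phi=(01)^\omega$, $\phi^*=(10)^\omega$ and $\oplus$ term-wise exclusive or, $\mathbf J_{\partial\mathcal F}(a)=a\oplus\phi$ and $\mathbf J_{\partial\mathcal F}(Sa)=S(a\oplus\phi^* )$. $\widehat{\mathbb R}=\mathbb R\cup\{\infty\}$. For $a=0^{n_0}1^{n_1}0^{n_2}\cdots$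 ($n_0\ge0$, $n_i\ge1$ for $i\ge1$; last exponent $\infty$ if eventually constant) let $\kappa(a)=[n_0,n_1,n_2,\dots]$ (continued fraction, $1/\infty=0$, $[\infty]=\infty$) and $\kappa(Sa)=-1/\kappa(a)$ (with $1/0=\infty$). Every irrational $x$ is $\kappa(w)$ for a unique $w\in\partial_I\mathcal F$, and $\mathbf J_{\mathbb R}:\mathbb R\setminus\mathbb Q\to\widehat{\mathbb R}$ is $\mathbf J_{\mathbb R}(x)=\kappa(\mathbf J_{\partial\mathcal F}(w))$. Convention $-\infty=\infty$ in $\widehat{\mathbb R}$. *)

(* Defs.v *)
From HB Require Import structures.
From mathcomp Require Import all_boot all_order all_algebra generic_quotient.
From mathcomp Require Import all_classical all_reals all_analysis.
Import numFieldNormedType.Exports.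

Set Implicit Arguments.
Unset Strict Implicit.
Unset Printing Implicit Defensive.

Import Order.TTheory GRing.Theory Num.Theory.
Local Open Scope classical_set_scope.
Local Open Scope ring_scope.
Local Open Scope quotient_scope.

Definition SL2Z := {M : 'M[int]_2 | \det M == 1}.
HB.instance Definition _ := Choice.on SL2Z.
HB.instance Definition _ := SubType.on SL2Z.

Definition mkSL2Z (M : 'M[int]_2) (detM : \det M == 1) : SL2Z :=
  exist (fun M : 'M[int]_2 => \det M == 1) M detM.

Lemma SL2Z_mul_subproof (M N : SL2Z) : \det (val M *m val N) == 1.
Proof. by rewrite det_mulmx (eqP (valP M)) (eqP (valP N)) mulr1. Qed.

Definition SL2Z_mul (M N : SL2Z) : SL2Z := mkSL2Z (SL2Z_mul_subproof M N).

Lemma SL2Z_one_subproof : \det (1%:M : 'M[int]_2) == 1.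
Proof. by rewrite det1. Qed.

Definition SL2Z_one : SL2Z := mkSL2Z SL2Z_one_subproof.

Lemma SL2Z_inv_subproof (M : SL2Z) : \det (invmx (val M)) == 1.
Proof. by rewrite det_inv (eqP (valP M)) invr1. Qed.

Definition SL2Z_inv (M : SL2Z) : SL2Z := mkSL2Z (SL2Z_inv_subproof M).

Lemma SL2Z_unitmx (M : SL2Z) : val M \in unitmx.
Proof. by rewrite unitmxE (eqP (valP M)) unitr1. Qed.

Definition pm_eq (M N : SL2Z) : bool :=
  (val M == val N) || (val M == - val N).

Lemma pm_eq_refl : reflexive pm_eq.
Proof. by move=> M; rewrite /pm_eq eqxx. Qed.

Lemma pm_eq_sym : symmetric pm_eq.
Proof.
by move=> M N; rewrite /pm_eq eq_sym; congr orb; rewrite eq_sym eqr_oppLR.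
Qed.

Lemma pm_eq_trans : transitive pm_eq.
Proof.
move=> N M P /orP[]/eqP MN /orP[]/eqP NP; apply/orP; rewrite MN NP ?opprK eqxx;
  by [left|right].
Qed.

Canonical pm_equiv := EquivRel pm_eq pm_eq_refl pm_eq_sym pm_eq_trans.

Definition PSL2Z := {eq_quot pm_eq}.
HB.instance Definition _ := EqQuotient.on PSL2Z.
HB.instance Definition _ := Choice.on PSL2Z.

Definition PSL2Z_mul (x y : PSL2Z) : PSL2Z :=
  \pi_PSL2Z (SL2Z_mul (repr x) (repr y)).
Definition PSL2Z_one : PSL2Z := \pi_PSL2Z SL2Z_one.
Definition PSL2Z_inv (x : PSL2Z) : PSL2Z := \pi_PSL2Z (SL2Z_inv (repr x)).

Lemma PSL2ZP (M N : SL2Z) :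
  reflect (\pi_PSL2Z M = \pi_PSL2Z N) (pm_eq M N).
Proof. by rewrite -[pm_eq M N]/(pm_equiv M N) -eqmodE; exact: eqP. Qed.

Lemma PSL2Z_reprE (M : SL2Z) : pm_eq (repr (\pi_PSL2Z M)) M.
Proof. by apply/PSL2ZP; rewrite reprK. Qed.

Lemma pi_mul (M N : SL2Z) :
  PSL2Z_mul (\pi M) (\pi N) = \pi_PSL2Z (SL2Z_mul M N).
Proof.
apply/PSL2ZP; rewrite /pm_eq /=.
by case/orP: (PSL2Z_reprE M) => /eqP ->; case/orP: (PSL2Z_reprE N) => /eqP ->;
  rewrite ?mulNmx ?mulmxN ?opprK eqxx ?orbT.
Qed.

Lemma pi_inv (M : SL2Z) : PSL2Z_inv (\pi M) = \pi_PSL2Z (SL2Z_inv M).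
Proof.
apply/PSL2ZP; rewrite /pm_eq /=.
case/orP: (PSL2Z_reprE M) => /eqP ->; rewrite ?eqxx//.
have uN : -1 *: val M \in unitmx.
  by rewrite unitmxE detZ unitrM unitrX ?unitrN1// -unitmxE SL2Z_unitmx.
by rewrite -[in X in _ || X]scaleN1r invmxZ// invrN1 scaleN1r eqxx orbT.
Qed.

Lemma PSL2Z_ind (P : PSL2Z -> Prop) : (forall M, P (\pi M)) -> forall x, P x.
Proof. by move=> piP x; rewrite -[x]reprK. Qed.

Lemma PSL2Z_mulA : associative PSL2Z_mul.
Proof.
elim/PSL2Z_ind => M; elim/PSL2Z_ind => N; elim/PSL2Z_ind => P.
by rewrite !pi_mul; congr (\pi _); apply: val_inj; rewrite /= mulmxA.
Qed.

Lemma PSL2Z_mul1 : left_id PSL2Z_one PSL2Z_mul.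
Proof.
elim/PSL2Z_ind => M; rewrite pi_mul; congr (\pi _).
by apply: val_inj; rewrite /= mul1mx.
Qed.

Lemma PSL2Z_mulr1 : right_id PSL2Z_one PSL2Z_mul.
Proof.
elim/PSL2Z_ind => M; rewrite pi_mul; congr (\pi _).
by apply: val_inj; rewrite /= mulmx1.
Qed.

Lemma PSL2Z_mulV : left_inverse PSL2Z_one PSL2Z_inv PSL2Z_mul.
Proof.
elim/PSL2Z_ind => M; rewrite pi_inv pi_mul; congr (\pi _).
by apply: val_inj; rewrite /= mulVmx// SL2Z_unitmx.
Qed.

Lemma PSL2Z_mulrV : right_inverse PSL2Z_one PSL2Z_inv PSL2Z_mul.
Proof.
elim/PSL2Z_ind => M; rewrite pi_inv pi_mul; congr (\pi _).
by apply: val_inj; rewrite /= mulmxV// SL2Z_unitmx.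
Qed.

HB.instance Definition _ := isGroup.Build PSL2Z
  PSL2Z_mulA PSL2Z_mul1 PSL2Z_mulr1 PSL2Z_mulV PSL2Z_mulrV.
HB.instance Definition _ := isPointed.Build PSL2Z (1%g : PSL2Z).

(* [mx2 a b c d] is the matrix of z |-> (a z + b) / (c z + d). *)
Definition mx2 (a b c d : int) : 'M[int]_2 :=
  \matrix_(i, j) if i == 0 then (if j == 0 then a else b)
                 else (if j == 0 then c else d).

Lemma det_mx2 a b c d : \det (mx2 a b c d) = a * d - b * c.
Proof. by rewrite (expand_det_row _ ord0) !big_ord_recl big_ord0 /cofactor !det_mx11 !mxE /= expr0 expr1 !mulNr !mul1r mulrN addr0. Qed.

Lemma mx2_S_subproof : \det (mx2 0 (-1) 1 0) == 1.
Proof. by rewrite det_mx2 !(mulr0, mulr1, mul0r, mulN1r, sub0r, subr0, opprK). Qed.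

Lemma mx2_L_subproof : \det (mx2 1 (-1) 1 0) == 1.
Proof. by rewrite det_mx2 !(mulr0, mulr1, mul0r, mulN1r, sub0r, subr0, opprK). Qed.

Definition gS : PSL2Z := \pi_PSL2Z (mkSL2Z mx2_S_subproof).
Definition gL : PSL2Z := \pi_PSL2Z (mkSL2Z mx2_L_subproof).

Lemma mx2M a b c d a' b' c' d' : mx2 a b c d *m mx2 a' b' c' d' =
  mx2 (a * a' + b * c') (a * b' + b * d') (c * a' + d * c') (c * b' + d * d').
Proof.
apply/matrixP => i j; rewrite !mxE !big_ord_recl big_ord0 !mxE /= addr0.
by case: (i == 0); case: (j == 0).
Qed.

Lemma pi_mx2_inj a b c d a' b' c' d' h h' :
  \pi_PSL2Z (@mkSL2Z (mx2 a b c d) h) = \pi_PSL2Z (@mkSL2Z (mx2 a' b' c' d') h') ->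
  exists s : bool, [/\ a = (-1) ^+ s * a', b = (-1) ^+ s * b',
    c = (-1) ^+ s * c' & d = (-1) ^+ s * d'].
Proof.
move=> /PSL2ZP/orP[]/eqP/= /matrixP E; [exists false|exists true].
all: by split; [move: (E 0 0)|move: (E 0 1)|move: (E 1 0)|move: (E 1 1)];
  rewrite !mxE /= ?mul1r ?mulN1r.
Qed.

Lemma mx2_L2_subproof : \det (mx2 0 (-1) 1 (-1)) == 1.
Proof.
by rewrite det_mx2 !(mulr0, mulr1, mul0r, mulN1r, sub0r, subr0, opprK).
Qed.

Lemma mx2_1_subproof : \det (mx2 1 0 0 1) == 1.
Proof. by rewrite det_mx2 !(mulr0, mulr1, subr0). Qed.

Lemma gL2E : (gL ^+ 2)%g = \pi_PSL2Z (mkSL2Z mx2_L2_subproof).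
Proof.
rewrite [LHS]pi_mul; congr (\pi _); apply: val_inj; rewrite /= mx2M.
by congr mx2.
Qed.

Lemma g1E : (1%g : PSL2Z) = \pi_PSL2Z (mkSL2Z mx2_1_subproof).
Proof.
rewrite -[LHS]/PSL2Z_one; congr (\pi _); apply: val_inj => /=.
by apply/matrixP => i j; rewrite !mxE; case: i j => [[|[|//]] ?] [[|[|//]] ?].
Qed.

Lemma gS2 : (gS ^+ 2 = 1)%g.
Proof.
rewrite [LHS]pi_mul g1E; apply/PSL2ZP/orP; right; apply/eqP; rewrite /= mx2M.
by apply/matrixP => i j; rewrite !mxE; case: i j => [[|[|//]] ?] [[|[|//]] ?].
Qed.

Lemma gL3 : (gL ^+ 3 = 1)%g.
Proof.
rewrite expgS gL2E [LHS]pi_mul g1E; apply/PSL2ZP/orP; right; apply/eqP.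
rewrite /= mx2M.
by apply/matrixP => i j; rewrite !mxE; case: i j => [[|[|//]] ?] [[|[|//]] ?].
Qed.

Lemma gS_neq1 : gS <> 1%g.
Proof. by rewrite g1E => /pi_mx2_inj[[] []]. Qed.

Lemma gL_neq1 : gL <> 1%g.
Proof. by rewrite g1E => /pi_mx2_inj[[] []]. Qed.

Lemma gL2_neq1 : (gL ^+ 2)%g <> 1%g.
Proof. by rewrite gL2E g1E => /pi_mx2_inj[[] []]. Qed.

Lemma gL_neqL2 : gL <> (gL ^+ 2)%g.
Proof. by rewrite gL2E => /pi_mx2_inj[[] []]. Qed.

Lemma gS_neqL : gS <> gL.
Proof. by move=> /pi_mx2_inj[[] []]. Qed.

Lemma gS_neqL2 : gS <> (gL ^+ 2)%g.
Proof. by rewrite gL2E => /pi_mx2_inj[[] []]. Qed.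

Definition cosetS (W : PSL2Z) : set PSL2Z := [set W; (W * gS)%g].
Definition cosetL (W : PSL2Z) : set PSL2Z :=
  [set W; (W * gL)%g; (W * gL ^+ 2)%g].

Definition farey_vertex (v : set PSL2Z) : Prop :=
  exists W, v = cosetS W \/ v = cosetL W.

(* The edge joining two adjacent vertices is their unique common element, so
   a path is recorded by its edges: [e n] joins [v n] and [v n.+1]. *)
Definition farey_path (e : nat -> PSL2Z) : Prop :=
  e 0%N = 1%g /\
  exists v : nat -> set PSL2Z,
    [/\ forall n, farey_vertex (v n),
        forall n, v n <> v n.+1,
        forall n, (v n `&` v n.+1) (e n)
      & forall n, v n <> v n.+2].

Record farey_end :=
  FareyEnd { edge :> nat -> PSL2Z ; edgeP : farey_path edge }.

HB.instance Definition _ := gen_eqMixin farey_end.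
HB.instance Definition _ := gen_choiceMixin farey_end.

Definition ends_through (g : PSL2Z) : set farey_end :=
  [set w | exists n, edge w n = g].

HB.instance Definition _ :=
  @isSubBaseTopological.Build farey_end PSL2Z setT ends_through.

Lemma farey_end_inj (w w' : farey_end) : edge w =1 edge w' -> w = w'.
Proof.
case: w w' => e eP [e' e'P] /= /funext ee'; case: _ / ee' in e'P *.
by congr FareyEnd; exact: Prop_irrelevance.
Qed.

Definition letter (w : nat -> PSL2Z) (n : nat) : PSL2Z :=
  ((w n)^-1 * w n.+1)%g.

(* [word_letter s a] is the sequence of letters of the word [a] if [s] is
   [false] and of [Sa] if [s] is [true], the digit [0] (i.e. [false]) being
   [LS] and the digit [1] (i.e. [true]) being [L^2 S]. *)
Definition word_letter (s : bool) (a : nat -> bool) (n : nat) : PSL2Z :=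
  if odd (n + s) then gS
  else if a (n - s)./2 then (gL ^+ 2)%g else gL.

Fixpoint word_edge (s : bool) (a : nat -> bool) (n : nat) : PSL2Z :=
  if n is m.+1 then (word_edge s a m * word_letter s a m)%g else 1%g.

Lemma cosetSP W x : cosetS W x -> cosetS W = cosetS x.
Proof.
case=> /= -> //; rewrite /cosetS -mulgA -expg2 gS2 mulg1.
by apply/seteqP; split => y [] ->; [right|left|right|left].
Qed.

Lemma cosetLP W x : cosetL W x -> cosetL W = cosetL x.
Proof.
have L3 : (gL * gL ^+ 2 = 1)%g by rewrite -expgS gL3.
have L3' : (gL ^+ 2 * gL = 1)%g by rewrite -expgSr gL3.
have L4 : (gL ^+ 2 * gL ^+ 2 = gL)%g by rewrite -expgnDr/= expgS gL3 mulg1.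
case=> [[]|] /= -> //; rewrite /cosetL -!mulgA ?L3 ?L3' ?L4 ?mulg1.
  by rewrite -expg2; apply/seteqP; split => y [[]|] -> //=; tauto.
by apply/seteqP; split => y [[]|] -> //=; tauto.
Qed.

Lemma cosetS_neq_cosetL W W' : cosetS W <> cosetL W'.
Proof.
move=> E; have /cosetSP E1 : cosetS W W' by rewrite E; left; left.
have : cosetS W' (W' * gL)%g by rewrite -E1 E; left; right.
case=> /= [|/mulgI/esym//]; last exact: gS_neqL.
by rewrite -[RHS]mulg1 => /mulgI; exact: gL_neq1.
Qed.

Lemma word_letterS (s : bool) a n : odd (n + s) -> word_letter s a n = gS.
Proof. by rewrite /word_letter => ->. Qed.

Lemma word_letterL (s : bool) a n : ~~ odd (n + s) ->
  word_letter s a n = gL \/ word_letter s a n = (gL ^+ 2)%g.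
Proof. by rewrite /word_letter => /negPf ->; case: ifP; [right|left]. Qed.

Lemma word_path s a : farey_path (word_edge s a).
Proof.
split=> //.
set e := word_edge s a.
have eS n : e n.+1 = (e n * word_letter s a n)%g by [].
pose v n := if odd (n + s) then cosetL (e n) else cosetS (e n).
have v1E n : v n.+1 = if odd (n + s) then cosetS (e n) else cosetL (e n).
  rewrite /v addSn /=; case: ifPn => [/negPf ns|/negbNE ns]; rewrite ns.
    apply/esym/cosetLP; rewrite eS.
    by case: (@word_letterL s a n (negbT ns)) => ->; [left; right|right].
  by apply/esym/cosetSP; rewrite eS word_letterS//; right.
exists v; split.
- by move=> n; exists (e n); rewrite /v; case: ifP; [right|left].
- move=> n; rewrite v1E /v; case: ifP => _; last exact: cosetS_neq_cosetL.
  by move/esym; exact: cosetS_neq_cosetL.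
- move=> n; split; [rewrite /v|rewrite v1E]; case: ifP => _;
    by [left|left; left].
- move=> n; rewrite v1E /v addSn /=; case: ifPn => [ns|ns].
    move=> /esym E.
    have : cosetL (e n) (e n.+1) by rewrite -E; left; left.
    rewrite eS word_letterS// => -[[]|] /=.
    + by rewrite -[RHS]mulg1 => /mulgI; exact: gS_neq1.
    + by move=> /mulgI; exact: gS_neqL.
    + by move=> /mulgI; exact: gS_neqL2.
  move=> /esym E.
  have : cosetS (e n) (e n.+1) by rewrite -E; left.
  rewrite eS; case: (@word_letterL s a n ns) => -> [] /=.
  + by rewrite -[RHS]mulg1 => /mulgI; exact: gL_neq1.
  + by move=> /mulgI/esym; exact: gS_neqL.
  + by rewrite -[RHS]mulg1 => /mulgI; exact: gL2_neq1.
  + by move=> /mulgI/esym; exact: gS_neqL2.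
Qed.

(* [word false a] is the end [a], and [word true a] is the end [Sa]. *)
Definition word (s : bool) (a : nat -> bool) : farey_end :=
  FareyEnd (word_path s a).

Definition starts_S (w : farey_end) : bool := letter w 0 == gS.

Definition digits (w : farey_end) (k : nat) : bool :=
  letter w (k.*2 + starts_S w) == (gL ^+ 2)%g.

Lemma letter_word s a n : letter (word s a) n = word_letter s a n.
Proof. by rewrite /letter /= mulKg. Qed.

Lemma starts_S_word s a : starts_S (word s a) = s.
Proof.
rewrite /starts_S letter_word /word_letter add0n oddb; case: s; rewrite ?eqxx//.
by case: ifP => _; apply/eqP => /esym; [exact: gS_neqL2|exact: gS_neqL].
Qed.

Lemma digits_word s a : digits (word s a) = a.
Proof.
apply/funext => k; rewrite /digits starts_S_word letter_word /word_letter.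
rewrite -addnA oddD odd_double oddD addbb /= addnK doubleK.
by case: ifP; rewrite ?eqxx// => _; apply/eqP; exact: gL_neqL2.
Qed.

Lemma wordK (w : farey_end) : word (starts_S w) (digits w) = w.
Proof.
case: (edgeP w) => e0 [v [vF vS ve vSS]].
pose cs (b : bool) := if b then cosetL else cosetS.
have cs_inj b b' x y : cs b x = cs b' y -> b = b'.
  case: b; case: b' => //= E.
    by case: (cosetS_neq_cosetL (esym E)).
  by case: (cosetS_neq_cosetL E).
have vE n x : v n x -> exists b, v n = cs b x.
  case: (vF n) => W [] -> vx; first by exists false; exact: cosetSP.
  by exists true; exact: cosetLP.
pose T n b := v n = cs b (w n) /\ v n.+1 = cs (~~ b) (w n).
have T_ex n : exists b, T n b.
  have [/vE[b vb] /vE[b' vb']] := ve n; exists b; split=> //; rewrite vb'.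
  case: (b =P ~~ b') => [->|bb']; first by rewrite negbK.
  by have := vS n; rewrite vb vb'; case: b b' bb' {vb vb'} => [] [].
have T_next n b : T n b -> T n.+1 (~~ b).
  by case=> _ vb; case: (T_ex n.+1) => b' Tb'; case: (Tb') => + _;
    rewrite vb => /cs_inj ->.
have e_neq n b : T n b -> w n.+1 <> w n.
  move=> Tb E; have [_] := T_next _ _ Tb.
  rewrite E negbK; case: (Tb) => <- _ /esym; exact: vSS.
have letterS n : T n true -> letter w n = gS.
  move=> Tn; have := e_neq _ _ Tn; have [/= + _] := ve n.+1; case: Tn => _ -> /=.
  by rewrite /letter; case=> /= ->; rewrite ?mulKg.
have letterL n : T n false -> letter w n = gL \/ letter w n = (gL ^+ 2)%g.
  move=> Tn; have := e_neq _ _ Tn; have [/= + _] := ve n.+1; case: Tn => _ -> /=.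
  by rewrite /letter => -[[]|] /= ->; rewrite ?mulKg//; [left|right].
have T_all n : T n (odd (n + starts_S w)).
  elim: n => [|n IH]; last by rewrite addSn; exact: T_next.
  rewrite add0n oddb; case: (T_ex 0%N) => -[] T0; rewrite /starts_S.
    by rewrite letterS// eqxx.
  by case: (letterL _ T0) => ->; case: eqP => // /esym;
    [move=> /gS_neqL|move=> /gS_neqL2].
apply: farey_end_inj => n; elim: n => [|n IH]; first by rewrite e0.
transitivity (w n * word_letter (starts_S w) (digits w) n)%g.
  by rewrite -IH.
rewrite -[RHS](mulVKg (w n)) -/(letter w n); congr (_ * _)%g; rewrite /word_letter; have := T_all n.
case: ifPn => [_ /letterS//|nodd /letterL wL].
have nE : ((n - starts_S w)./2.*2 + starts_S w = n)%N.
  have hn : (starts_S w <= n)%N by case: (starts_S w) nodd => //; case: (n).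
  by rewrite even_halfK ?subnK// oddB// -oddD.
rewrite /digits nE; case: wL => ->; rewrite ?eqxx//.
by case: eqP => // /gL_neqL2.
Qed.

Definition farey_S (w : farey_end) : farey_end := word (~~ starts_S w) (digits w).

Definition farey_U (w : farey_end) : farey_end :=
  word (starts_S w) (fun n => ~~ digits w n).

Definition farey_V (w : farey_end) : farey_end := farey_S (farey_U w).

Definition phi (n : nat) : bool := odd n.
Definition phi_star (n : nat) : bool := ~~ odd n.

Definition farey_J (w : farey_end) : farey_end :=
  if starts_S w then word true (fun n => digits w n (+) phi_star n)
  else word false (fun n => digits w n (+) phi n).

Lemma farey_V_US w : farey_V w = farey_U (farey_S w).
Proof. by rewrite /farey_V /farey_S /farey_U !starts_S_word !digits_word. Qed.

Lemma word_edge_true a n :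
  word_edge true a n.+1 = (gS * word_edge false a n)%g.
Proof.
elim: n => [|n IH]; first by rewrite /= mul1g mulg1.
transitivity (word_edge true a n.+1 * word_letter true a n.+1)%g => //.
rewrite IH -mulgA; congr (_ * (_ * _))%g.
by rewrite /word_letter addn1 addn0 /= negbK subn1 subn0.
Qed.

(* [farey_S] is left multiplication by [S], up to backtracking. *)
Lemma edge_farey_S0 w n : ~~ starts_S w ->
  edge (farey_S w) n.+1 = (gS * edge w n)%g.
Proof.
move=> wF; rewrite -[in RHS](wordK w) /farey_S (negPf wF).
exact: word_edge_true.
Qed.

Lemma edge_farey_S1 w n : starts_S w ->
  edge (farey_S w) n = (gS * edge w n.+1)%g.
Proof.
move=> wT; rewrite -[in RHS](wordK w) /farey_S wT.
by rewrite [edge _ n.+1]word_edge_true mulgA -expg2 gS2 mul1g.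
Qed.

Definition homeomorphism (X Y : topologicalType) (f : X -> Y) : Prop :=
  continuous f /\
  exists g : Y -> X, [/\ continuous g, cancel f g & cancel g f].

Notation Rhat R := (one_point_compactification R).

Section continued_fractions.
Variable R : realType.

Definition Rhat_inv (z : Rhat R) : Rhat R :=
  if z is Some x then (if x == 0 then None else Some x^-1) else Some 0.

Definition Rhat_opp (z : Rhat R) : Rhat R :=
  if z is Some x then Some (- x) else None.

Definition Rhat_addn (m : nat) (z : Rhat R) : Rhat R :=
  if z is Some x then Some (m%:R + x) else None.

(* Exponents lie in [option nat], [None] standing for the exponent infinity.
   [cfrac_trunc n k] is the finite continued fraction [n_0, ..., n_k], cut at
   the first infinite exponent if there is one. *)
Fixpoint cfrac_trunc (n : nat -> option nat) (k : nat) : Rhat R :=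
  if n 0%N is Some m then
    if k is k'.+1 then
      Rhat_addn m (Rhat_inv (cfrac_trunc (fun i => n i.+1) k'))
    else Some m%:R
  else None.

(* If some exponent is infinite, then [cfrac_trunc n] is eventually constant
   and [cfrac n] is the value of a finite continued fraction. *)
Definition cfrac (n : nat -> option nat) : Rhat R :=
  lim (cfrac_trunc n k @[k --> \oo]).

(* The length of the maximal initial block of [c]'s in [a]. *)
Definition run (c : bool) (a : nat -> bool) : option nat :=
  match pselect (exists k, a k != c) with
  | left a_neqc => Some (ex_minn a_neqc)
  | right _ => None
  end.

Fixpoint exponents_from (c : bool) (a : nat -> bool) (i : nat) : option nat :=
  if i is i'.+1 then
    if run c a is Some m then exponents_from (~~ c) (fun k => a (m + k)%N) i'
    else None
  else run c a.

Definition exponents (a : nat -> bool) : nat -> option nat :=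
  exponents_from false a.

Definition kappa (w : farey_end) : Rhat R :=
  if starts_S w then Rhat_opp (Rhat_inv (cfrac (exponents (digits w))))
  else cfrac (exponents (digits w)).

(* For irrational [x] there is exactly one [w] with [kappa w = Some x]; the
   value at rational [x] is irrelevant. *)
Definition J_R (x : R) : Rhat R :=
  kappa (farey_J (xget (word false (fun=> false))
                       [set w | kappa w = Some x])).

End continued_fractions.

(* Main.v *)
Require Import Defs.
From mathcomp Require Import all_boot all_order all_algebra.
From mathcomp Require Import all_classical all_reals all_analysis.
From mathcomp Require Import finmap ring lra zify.

(** The algebra of the theorem takes place on words.  An end of the Farey tree
    is a pair of a sign bit and a binary sequence ([wordK]), and both [farey_S]
    and [farey_J] act on it one digit at a time.  [S] exchanges the two sign
    bits, hence the masks [phi] and [phi_star]; since these are each other's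
    negation, commuting [J] past [S] costs exactly one negation of all the
    digits, which is the content of [J S = V J].

    The statement about the real line follows once [kappa] is known to turn [V]
    into [z |-> -z] and [S] into [z |-> -1/z], and to be bijective above the
    irrational numbers. Convergence of the continued fractions is part of this,
    because [kappa] is a limit and [J] may send an end over an irrational
    number to one with eventually constant digits. It is obtained digit by
    digit. In the coordinate [r = x / (1 + x)] of [[0, oo]], a digit 0 in front
    of a word, which is [x |-> x + 1], becomes [r |-> 1 / (2 - r)]; a digit 1,
    which is [x |-> x / (1 + x)], becomes [r |-> r / (1 + r)]. These are the
    two inverse branches of the Farey map. Both send points at distance [d] to
    points at distance at most [d / (1 + d)], so [j] of them shrink [[0, 1]] to
    a length at most [1 / (j + 1)], whatever the digits ([branches_width]).
    Hence every word codes one point of [[0, 1]] ([coded]); the truncated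
    continued fractions of the word converge to that point, at a rate that does
    not depend on the word and with no exception for infinite exponents
    ([chord_cfrac_trunc_itv], [cfrac_exponents]). Negating the digits is [r |->
    1 - r], that is [x |-> 1 / x] ([coded_flip]). Every point is coded by its
    orbit under the Farey map, and an irrational point by nothing else, because
    the images of the two branches meet only in [1 / 2] ([coded_farey_code],
    [coded_inj]).

    Continuity needs that the ends through a given edge are those that share a
    given prefix, because an element of [PSL_2(Z)] has only one reduced word
    in [S], [L], [L^2].  The latter is a ping-pong argument on the columns of the
    matrices ([word_edge_inj]).  A map that treats the digits separately sends
    ends with a long common prefix to ends with a long common prefix, so it is
    continuous ([digitwise_continuous]); [J] and [S] are such maps, and they are
    involutions. *)

Set Implicit Arguments.
Unset Strict Implicit.
Unset Printing Implicit Defensive.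

Import Order.TTheory GRing.Theory Num.Theory.
Import numFieldNormedType.Exports.

Local Open Scope classical_set_scope.
Local Open Scope ring_scope.

Definition tail (a : nat -> bool) : nat -> bool := fun k => a k.+1.
Definition flip (a : nat -> bool) : nat -> bool := fun k => ~~ a k.

(** * Coding of [0, 1] by the inverse branches of the Farey map *)

Section FareyCoding.
Variable R : realType.
Implicit Types (a b : nat -> bool) (r s : R) (j : nat).

(** [branch d] is [x |-> x + 1] (for [d = false]) or [x |-> x / (1 + x)] (for
    [d = true]), read in the coordinate [r = x / (1 + x)]. *)
Definition branch (d : bool) r : R := if d then r / (1 + r) else (2 - r)^-1.

Fixpoint branches a j r : R :=
  if j is i.+1 then branch (a 0%N) (branches (tail a) i r) else r.

Lemma branch_ge0le1 d r : 0 <= r <= 1 -> 0 <= branch d r <= 1.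
Proof.
move=> /andP[r0 r1]; rewrite /branch; case: d; apply/andP; split.
- by apply: divr_ge0; lra.
- by rewrite ler_pdivrMr; lra.
- by rewrite invr_ge0; lra.
- by rewrite invf_le1; lra.
Qed.

Lemma branches_ge0le1 a j r : 0 <= r <= 1 -> 0 <= branches a j r <= 1.
Proof. by move=> r01; elim: j a => [//|j IH] a; exact: branch_ge0le1. Qed.

(** Both branches are homographies, so their difference quotients factor; order
    preservation, contraction and injectivity are all read off this formula. *)
Lemma branchB d r s : 0 <= r <= 1 -> 0 <= s <= 1 ->
  branch d s - branch d r =
  (s - r) / (if d then (1 + r) * (1 + s) else (2 - r) * (2 - s)).
Proof.
by move=> /andP[r0 r1] /andP[s0 s1]; rewrite /branch; case: d; field;
  apply/andP; split; lra.
Qed.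

Lemma branch_le d r s : 0 <= r -> r <= s -> s <= 1 -> branch d r <= branch d s.
Proof.
move=> r0 rs s1; rewrite -subr_ge0 branchB; [|lra..].
by apply: divr_ge0; [lra|case: d; apply: mulr_ge0; lra].
Qed.

Lemma branches_le a j r s : 0 <= r -> r <= s -> s <= 1 ->
  branches a j r <= branches a j s.
Proof.
move=> r0 rs s1; elim: j a => [//|j IH] a /=.
have /andP[? _] := @branches_ge0le1 (tail a) j r ltac:(lra).
have /andP[_ ?] := @branches_ge0le1 (tail a) j s ltac:(lra).
exact: branch_le.
Qed.

(** [d' <= d / (1 + d)] for the distances [d], [d'] before and after a branch.
    Each branch has a fixed point of derivative 1, so no uniform factor
    exists; but the inequality says that the inverse distance grows by at least
    1. *)
Lemma branch_contract d r s : 0 <= r -> r <= s -> s <= 1 ->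
  (branch d s - branch d r) * (1 + (s - r)) <= s - r.
Proof.
move=> r0 rs s1; rewrite branchB; [|lra..].
rewrite mulrAC ler_pdivrMr; last by case: d; apply: mulr_gt0; lra.
by apply: ler_wpM2l; [lra|case: d; nra].
Qed.

Lemma branches_width a j : branches a j 1 - branches a j 0 <= j.+1%:R^-1.
Proof.
elim: j a => [|j IH] a /=; first by rewrite invr1; lra.
set r := branches _ _ 0; set s := branches _ _ 1.
have /andP[r0 _] : 0 <= r <= 1 by apply: branches_ge0le1; lra.
have /andP[_ s1] : 0 <= s <= 1 by apply: branches_ge0le1; lra.
have rs : r <= s by apply: branches_le; lra.
have := branch_contract (a 0%N) r0 rs s1.
have := IH (tail a); rewrite -/r -/s => {IH}.
have j1 : 1 <= j.+1%:R :> R by rewrite ler1n.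
rewrite -[in X in X -> _]div1r -[in X in _ -> _ -> X]div1r.
rewrite !ler_pdivlMr ?ltr0n// -(natr1 j.+1).
move: (j.+1%:R) j1 => n n1 H1 H2.
set x := _ - _ in H1 H2 *; set y := branch _ _ - _ in H2 *.
have x0 : 0 <= x by rewrite /x; lra.
have [y0|y0] := leP y 0; first by nra.
have : y * (1 + n * x) <= y * 2 by apply: ler_wpM2l; nra.
nra.
Qed.

(** The intervals [[branches a j 0, branches a j 1]] are nested: this and the
    next lemma give the monotonicity of their ends. *)
Lemma branches0_homo a i j : (i <= j)%N -> branches a i 0 <= branches a j 0.
Proof.
elim: i j a => [|i IH] [|j] a //= ij.
  have /andP[] := @branches_ge0le1 a j.+1 0 ltac:(lra).
  by [].
have /andP[? _] := @branches_ge0le1 (tail a) i 0 ltac:(lra).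
have /andP[_ ?] := @branches_ge0le1 (tail a) j 0 ltac:(lra).
by apply: branch_le => //; exact: IH.
Qed.

Lemma branches1_homo a i j : (i <= j)%N -> branches a j 1 <= branches a i 1.
Proof.
elim: i j a => [|i IH] [|j] a //= ij.
  have /andP[] := @branches_ge0le1 a j.+1 1 ltac:(lra).
  by [].
have /andP[_ ?] := @branches_ge0le1 (tail a) i 1 ltac:(lra).
have /andP[? _] := @branches_ge0le1 (tail a) j 1 ltac:(lra).
by apply: branch_le => //; exact: IH.
Qed.

(** [r |-> 1 - r] is [x |-> 1 / x], which conjugates the two branches. *)
Lemma branches_flip a j r : 0 <= r <= 1 ->
  branches (flip a) j r = 1 - branches a j (1 - r).
Proof.
move=> r01; elim: j a => [|j IH] a /=; first by ring.
rewrite (IH (tail a)) {IH}.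
have /andP[x0 x1] := @branches_ge0le1 (tail a) j (1 - r) ltac:(lra).
move: (branches _ _ _) x0 x1 => x x0 x1.
rewrite /branch /flip.
by case: (a 0%N) => /=; field; try (apply/andP; split); apply/eqP; lra.
Qed.

(** The common point of the nested intervals attached to the prefixes. *)
Definition coded a : R := sup (range (fun j => branches a j 0)).

Lemma coded_itv a j : branches a j 0 <= coded a <= branches a j 1.
Proof.
have ub i : ubound (range (fun j => branches a j 0)) (branches a i 1).
  move=> _ [k _ <-].
  apply: le_trans (branches0_homo a (leq_maxl k i)) _.
  apply: le_trans (branches1_homo a (leq_maxr k i)).
  by apply: branches_le; lra.
apply/andP; split; last by apply: ge_sup => //; exists (branches a 0 0), 0%N.
by apply: ub_le_sup; [exists (branches a 0 1); exact: ub|exists j].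
Qed.

Lemma coded_ge0le1 a : 0 <= coded a <= 1.
Proof. exact: (coded_itv a 0). Qed.

Lemma coded_dist a j r : branches a j 0 <= r <= branches a j 1 ->
  `|coded a - r| <= j.+1%:R^-1.
Proof.
move=> /andP[? ?]; have /andP[? ?] := coded_itv a j.
have := branches_width a j; move: (_^-1) => e ?.
by rewrite ler_norml; apply/andP; split; lra.
Qed.

Lemma coded_unique a r :
  (forall j, branches a j 0 <= r <= branches a j 1) -> r = coded a.
Proof.
move=> H; apply/eqP; rewrite eq_sym -subr_eq0 -normr_le0.
apply/ler_addgt0Pl => e e0.
rewrite addr0; have [j] := @ltr_add_invr R 0 e e0.
by rewrite add0r => /ltW; apply: le_trans; exact: coded_dist.
Qed.

Lemma coded_branch a : coded a = branch (a 0%N) (coded (tail a)).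
Proof.
apply/esym/coded_unique => -[|j] /=.
  exact: branch_ge0le1 (coded_ge0le1 _).
have /andP[] := coded_itv (tail a) j.
have /andP[? ?] := coded_ge0le1 (tail a).
have /andP[? ?] := @branches_ge0le1 (tail a) j 0 ltac:(lra).
have /andP[? ?] := @branches_ge0le1 (tail a) j 1 ltac:(lra).
by move=> ? ?; apply/andP; split; apply: branch_le.
Qed.

Lemma coded_flip a : coded (flip a) = 1 - coded a.
Proof.
apply/esym/coded_unique => j; have := coded_itv a j.
by rewrite !branches_flip ?subr0 ?subrr; lra.
Qed.

(** At [1 / 2], where the images of the two branches meet, the digit 0 is
    chosen. *)
Definition farey_digit r : bool := r < 2^-1.
Definition farey_map r : R :=
  if farey_digit r then r / (1 - r) else 2 - r^-1.
Definition farey_code r (k : nat) : bool := farey_digit (iter k farey_map r).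

Lemma farey_map_ge0le1 r : 0 <= r <= 1 -> 0 <= farey_map r <= 1.
Proof.
rewrite /farey_map /farey_digit => /andP[r0 r1]; case: ltP => rh.
  by apply/andP; split; [apply: divr_ge0|rewrite ler_pdivrMr]; lra.
have r2 : r^-1 <= 2 by rewrite invf_ple ?posrE; lra.
have : 1 <= r^-1 by rewrite invf_ge1; lra.
lra.
Qed.

Lemma branch_farey_map r : 0 <= r <= 1 ->
  branch (farey_digit r) (farey_map r) = r.
Proof.
rewrite /farey_map /farey_digit => /andP[r0 r1] /=; case: ltP => rh /=.
  by field; rewrite andbC; apply/andP; split; lra.
by rewrite opprB addrC subrK invrK.
Qed.

Lemma farey_code_tail r : tail (farey_code r) = farey_code (farey_map r).
Proof. by apply/funext => k; rewrite /tail /farey_code iterSr. Qed.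

Lemma coded_farey_code r : 0 <= r <= 1 -> coded (farey_code r) = r.
Proof.
move=> r01; apply/esym/coded_unique => j; elim: j r r01 => [//|j IH] r r01 /=.
rewrite farey_code_tail -[X in _ <= X <= _](branch_farey_map r01).
have f01 := farey_map_ge0le1 r01; have /andP[b0 b1] := IH _ f01.
have /andP[? ?] := @branches_ge0le1 (farey_code (farey_map r)) j 0 ltac:(lra).
have /andP[? ?] := @branches_ge0le1 (farey_code (farey_map r)) j 1 ltac:(lra).
by apply/andP; split; apply: branch_le; lra.
Qed.

(** The branches have rational coefficients. *)
Lemma coded_irrational_tail a : irrational (coded a) ->
  irrational (coded (tail a)).
Proof.
rewrite coded_branch => irr [q _ qE]; apply: irr; rewrite -qE.
exists (if a 0%N then q / (1 + q) else (2 - q)^-1) => //.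
rewrite /branch; case: (a 0%N); last by rewrite fmorphV rmorphB rmorph_nat.
by rewrite rmorphM fmorphV rmorphD rmorph1.
Qed.

(** The two branches map [[0, 1]] onto [[1 / 2, 1]] and [[0, 1 / 2]], and an
    irrational point is not in both. *)
Lemma coded_head_inj a b : irrational (coded a) -> coded a = coded b ->
  a 0%N = b 0%N.
Proof.
move=> irr; rewrite coded_branch in irr *; rewrite [coded b]coded_branch.
have half : 2^-1 != branch (a 0%N) (coded (tail a)).
  apply/eqP => E; apply: irr; rewrite -E; exists (2^-1 : rat) => //.
  by rewrite fmorphV rmorph_nat.
have low c : branch true (coded c) <= 2^-1.
  have /andP[? ?] := coded_ge0le1 c.
  by rewrite /branch ler_pdivrMr; lra.
have high c : 2^-1 <= branch false (coded c).
  have /andP[? ?] := coded_ge0le1 c.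
  by rewrite /branch lef_pV2 ?posrE; lra.
case: (a 0%N) (b 0%N) half => -[] // half E; case/eqP: half; apply/le_anti.
  by rewrite low E high.
by rewrite high E low.
Qed.

Lemma branch_inj d r s : 0 <= r <= 1 -> 0 <= s <= 1 ->
  branch d r = branch d s -> r = s.
Proof.
move=> r01 s01 /eqP; rewrite -subr_eq0 branchB// mulf_eq0 invr_eq0.
move=> /orP[|]; first by rewrite subr_eq0 => /eqP.
by case: d => /eqP; nra.
Qed.

Lemma coded_inj a b : irrational (coded a) -> coded a = coded b -> a = b.
Proof.
move=> irr ab; apply/funext => k; elim: k a b irr ab => [|k IH] a b irr ab.
  exact: coded_head_inj.
apply: (IH (tail a) (tail b)); first exact: coded_irrational_tail.
apply: (@branch_inj (a 0%N)); rewrite ?coded_ge0le1// -coded_branch ab.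
by rewrite (coded_head_inj irr ab) -coded_branch.
Qed.

End FareyCoding.

(** * Continued fractions and the map kappa *)

Lemma runP c a :
  (exists m, [/\ run c a = Some m, a m != c & forall k, (k < m)%N -> a k = c])
  \/ run c a = None /\ forall k, a k = c.
Proof.
rewrite /run; case: pselect => [ex|nex]; [left|right].
  case: ex_minnP => m am mmin; exists m; split=> // k km; apply/eqP.
  by apply: contraTT km => /mmin; rewrite -leqNgt.
by split=> // k; apply/eqP/negPn/negP => akc; apply: nex; exists k.
Qed.

Lemma run_Some c a m : a m != c -> (forall k, (k < m)%N -> a k = c) ->
  run c a = Some m.
Proof.
move=> am amin; have [[n [-> an nmin]]|[_ ac]] := runP c a; last first.
  by rewrite ac eqxx in am.
congr Some; apply/eqP; rewrite eqn_leq (leqNgt n) (leqNgt m).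
by apply/andP; split; apply/negP;
  [move=> /nmin E; rewrite E eqxx in am|move=> /amin E; rewrite E eqxx in an].
Qed.

Lemma run_None c a : (forall k, a k = c) -> run c a = None.
Proof.
by move=> ac; have [[m [_ + _]]|[]//] := runP c a; rewrite ac eqxx.
Qed.

Lemma run_flip c a : run (~~ c) a = run c (flip a).
Proof.
have [[m [-> am amin]]|[-> ac]] := runP (~~ c) a; apply/esym.
  apply: run_Some => [|k /amin]; rewrite /flip; last first.
    by move=> ->; rewrite negbK.
  by case: (a m) am {amin}; case: c.
by apply: run_None => k; rewrite /flip ac negbK.
Qed.

Lemma exponents_from_flip c a i :
  exponents_from (~~ c) a i = exponents_from c (flip a) i.
Proof.
by elim: i c a => [|i IH] c a /=; rewrite run_flip//; case: run => // m.
Qed.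

Lemma run_false0 a : a 0%N = false -> run false a = omap S (run false (tail a)).
Proof.
move=> a0; have [[m [-> am amin]]|[-> ac]] := runP false (tail a).
  by apply: run_Some => // -[|k]// /amin.
by apply: run_None => -[|k]//; exact: ac.
Qed.

(** A leading 0 lengthens the first block by one, so it adds 1 to the
    continued fraction. *)
Lemma exponents_0 a i : a 0%N = false -> exponents a i =
  if i is 0 then omap S (exponents (tail a) 0) else exponents (tail a) i.
Proof.
move=> a0; rewrite /exponents; case: i => [|i] /=; rewrite run_false0//.
by case: run.
Qed.

(** A word starting with 1 has an empty first block of 0s, and the rest of its
    block structure is that of its negation: the continued fraction is
    inverted. *)
Lemma exponents_1 a i : a 0%N = true ->
  exponents a i = if i is j.+1 then exponents (flip a) j else Some 0%N.
Proof.
move=> a0; have r0 : run false a = Some 0%N by apply: run_Some; rewrite ?a0.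
rewrite /exponents; case: i => [//|i] /=; rewrite r0.
exact: (exponents_from_flip false).
Qed.

Section ContinuedFractions.
Variable R : realType.
Implicit Types (a b : nat -> bool) (r s x : R) (z : Rhat R).

Definition Rhat_ge0 z : bool := if z is Some x then 0 <= x else true.

Lemma Rhat_addn_ge0 m z : Rhat_ge0 z -> Rhat_ge0 (Rhat_addn m z).
Proof. by case: z => //= x x0; rewrite addr_ge0. Qed.

Lemma Rhat_inv_ge0 z : Rhat_ge0 z -> Rhat_ge0 (Rhat_inv z).
Proof. by case: z => //= x x0; case: ifP => //= _; rewrite invr_ge0. Qed.

Lemma Rhat_addn0 z : Rhat_addn 0 z = z.
Proof. by case: z => //= x; rewrite add0r. Qed.

Lemma Rhat_oppK : involutive (@Rhat_opp R).
Proof. by case=> //= x; rewrite opprK. Qed.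

Lemma Rhat_invK : involutive (@Rhat_inv R).
Proof.
case=> [x|] /=; last by rewrite eqxx.
by have [->//|x0] /= := eqVneq x 0; rewrite invr_eq0 (negPf x0) invrK.
Qed.

Lemma Rhat_invN z : Rhat_inv (Rhat_opp z) = Rhat_opp (Rhat_inv z).
Proof.
case: z => [x|] /=; last by rewrite oppr0.
by rewrite oppr_eq0; case: ifP => //= _; rewrite invrN.
Qed.

Lemma cfrac_trunc_ge0 n k : Rhat_ge0 (cfrac_trunc R n k).
Proof.
elim: k n => [|k IH] n /=; case: (n 0%N) => //= m.
by apply/Rhat_addn_ge0/Rhat_inv_ge0.
Qed.

Lemma cfrac_trunc_exponents0 a k : a 0%N = false ->
  cfrac_trunc R (exponents a) k =
  Rhat_addn 1 (cfrac_trunc R (exponents (tail a)) k).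
Proof.
move=> a0; have tailE : (fun i => exponents a i.+1) =
    (fun i => exponents (tail a) i.+1).
  by apply/funext => i; rewrite exponents_0.
case: k => [|k] /=; rewrite ?tailE exponents_0//; case: exponents => //= m.
  by rewrite -natr1 addrC.
by case: Rhat_inv => //= x; rewrite -natr1 (addrC m%:R) addrA.
Qed.

Lemma cfrac_trunc_exponents1 a k : a 0%N = true ->
  cfrac_trunc R (exponents a) k.+1 =
  Rhat_inv (cfrac_trunc R (exponents (flip a)) k).
Proof.
move=> a0; have tailE : (fun i => exponents a i.+1) = exponents (flip a).
  by apply/funext => i; rewrite exponents_1.
by rewrite /= exponents_1// tailE Rhat_addn0.
Qed.

(** The homeomorphism [x |-> x / (1 + x)] of [[0, oo]] onto [[0, 1]], in which
    infinity is an ordinary point. *)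
Definition chord z : R := if z is Some x then x / (1 + x) else 1.
Definition unchord r : Rhat R := if r == 1 then None else Some (r / (1 - r)).

Lemma chord_ge0le1 z : Rhat_ge0 z -> 0 <= chord z <= 1.
Proof.
case: z => [x|_] /=; last by rewrite lexx ler01.
by move=> x0; rewrite divr_ge0 ?ler_pdivrMr; lra.
Qed.

Lemma chordK z : Rhat_ge0 z -> unchord (chord z) = z.
Proof.
case: z => [x|] /=; last by rewrite /unchord eqxx.
move=> x0; rewrite /unchord ifF.
  congr Some; field; rewrite addrK oner_eq0 andbT; apply/eqP; lra.
apply/negbTE/eqP => /(congr1 ( *%R^~ (1 + x))) /=.
by rewrite divfK; [|apply/eqP]; lra.
Qed.

Lemma unchordK r : 0 <= r <= 1 -> chord (unchord r) = r.
Proof.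
move=> r01; rewrite /unchord; have [->//|r1] := eqVneq r 1.
rewrite /chord; by field; rewrite subrK oner_eq0 andbT subr_eq0 eq_sym.
Qed.

Lemma unchord_ge0 r : 0 <= r <= 1 -> Rhat_ge0 (unchord r).
Proof.
by move=> r01; rewrite /unchord; case: ifP => //= _; apply: divr_ge0; lra.
Qed.

Lemma chord_add1 z : Rhat_ge0 z ->
  chord (Rhat_addn 1 z) = branch false (chord z).
Proof.
case: z => [x|_] /=; last by field.
by move=> x0; field; apply/andP; split; apply/eqP; lra.
Qed.

Lemma chord_inv z : Rhat_ge0 z -> chord (Rhat_inv z) = 1 - chord z.
Proof.
case: z => [x|_] /=; last by lra.
have [->|xn0] /= := eqVneq x 0; first by lra.
by move=> x0; field; rewrite xn0 andbT; apply/eqP; lra.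
Qed.

Lemma Rhat_inv_unchord r : 0 <= r <= 1 ->
  Rhat_inv (unchord r) = unchord (1 - r).
Proof.
move=> r01; have u0 := unchord_ge0 r01.
by rewrite -[LHS]chordK ?Rhat_inv_ge0// chord_inv// unchordK.
Qed.

(** A leading 0 leaves the index of a truncation unchanged, while a leading 1
    lowers it by one: an inversion, followed by the leading 0 of the negated
    word.  So [k] digits can be removed from the [k]-th truncation, and what
    remains is still a point of [[0, oo]]. *)
Lemma chord_cfrac_trunc_itv a j k : (j <= k)%N ->
  branches a j 0 <= chord (cfrac_trunc R (exponents a) k) <= branches a j 1.
Proof.
elim: j k a => [|j IH] k a jk; first exact/chord_ge0le1/cfrac_trunc_ge0.
have b0 b : 0 <= branches b j (0 : R) <= 1 by apply: branches_ge0le1; lra.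
have b1 b : 0 <= branches b j (1 : R) <= 1 by apply: branches_ge0le1; lra.
rewrite /=; have [a0|a0] := boolP (a 0%N).
  case: k jk => // k jk.
  rewrite cfrac_trunc_exponents1// chord_inv ?cfrac_trunc_ge0//.
  rewrite cfrac_trunc_exponents0; last by rewrite /flip a0.
  rewrite chord_add1 ?cfrac_trunc_ge0//.
  have /andP[] := IH k (tail (flip a)) jk.
  have /andP[] := chord_ge0le1 (cfrac_trunc_ge0 (exponents (tail (flip a))) k).
  move: (chord _) => y y0 y1; rewrite !(branches_flip (tail a)) ?lexx ?ler01//.
  rewrite subr0 subrr => l u.
  (* A digit 1 is a digit 0 conjugated by inversion. *)
  have -> : 1 - branch false y = branch true (1 - y).
    by rewrite /branch; field; apply/eqP; lra.
  have /andP[? _] := b0 (tail a); have /andP[_ ?] := b1 (tail a).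
  by apply/andP; split; apply: branch_le; lra.
rewrite cfrac_trunc_exponents0; last exact/negbTE.
rewrite chord_add1 ?cfrac_trunc_ge0//.
have /andP[l u] := IH k (tail a) (ltnW jk).
have /andP[? _] := b0 (tail a); have /andP[_ ?] := b1 (tail a).
by apply/andP; split; apply: branch_le; lra.
Qed.

Lemma chord_cfrac_trunc_cvg a :
  chord (cfrac_trunc R (exponents a) k) @[k --> \oo] --> coded R a.
Proof.
apply/cvgrPdist_le => e e0; near=> k.
apply: le_trans (coded_dist (chord_cfrac_trunc_itv a (leqnn k))) _.
by apply: ltW; near: k; exact: near_infty_natSinv_lt (PosNum e0).
Unshelve. all: by end_near. Qed.

(** At 1 this says that [r / (1 - r)] leaves every compact set. *)
Lemma unchord_continuous : continuous unchord.
Proof.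
move=> r; have [->{r}|r1] := eqVneq r 1; last first.
  have rN1 : \forall s \near (r : R), s != 1.
    by apply: (@open_nbhs_nbhs R); split=> //; exact: open_neq.
  have E : unchord @ r `=>` (fun s => Some (s / (1 - s)) : Rhat R) @ r.
    apply: near_eq_cvg; apply: filterS rN1 => s s1.
    by rewrite /unchord (negPf s1).
  apply: (cvg_trans E); rewrite /unchord (negPf r1).
  apply: (@cvg_comp _ _ _ (fun s : R => s / (1 - s)) (Some : R -> Rhat R) _
    (nbhs (r / (1 - r)))); last first.
    exact: one_point_compactification_some_continuous.
  apply: cvgM; first exact: cvg_id.
  apply: cvgV; first by rewrite subr_eq0 eq_sym.
  by apply: cvgB; [exact: cvg_cst|exact: cvg_id].
rewrite /continuous_at {2}/unchord eqxx => U [C [Ccpt _] CU].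
have [M [_ CM]] := compact_bounded Ccpt.
pose N := `|M| + 1.
have N0 : 0 < N by rewrite ltr_wpDl.
have {CM}CN x : C x -> `|x| <= N by apply: CM; rewrite /N ltr_pwDr// ler_norm.
rewrite -[nbhs _ _]/(nbhs (1 : R) (unchord @^-1` U)).
near=> s; apply: CU; have [->|s1] := eqVneq s 1.
  by right; rewrite /unchord eqxx.
left; exists (s / (1 - s)); last by rewrite /unchord (negPf s1).
move=> /CN; apply/negP; rewrite -ltNge normrM normfV.
have s1' : 0 < `|1 - s| by rewrite normr_gt0 subr_eq0 eq_sym.
rewrite ltr_pdivlMr//.
have sh : 1 / 2 < s by near: s; apply: lt_nbhsr; lra.
have : `|1 - s| < (2 * N)^-1.
  near: s; apply: (@cvgr_dist_lt _ R^o _ _ _ id 1); first exact: cvg_id.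
  by rewrite invr_gt0 mulr_gt0.
rewrite -[ltRHS]div1r ltr_pdivlMr ?mulr_gt0// => sN.
by have := ler_norm s; nra.
Unshelve. all: by end_near. Qed.

Lemma cfrac_exponents a : cfrac R (exponents a) = unchord (coded R a).
Proof.
(* Limits are unique because [R] is locally compact and Hausdorff. *)
apply: cvg_lim.
  apply: one_point_compactification_hausdorff; last exact: Rhausdorff.
  exact: locally_compactR.
have -> : cfrac_trunc R (exponents a) =
    fun k => unchord (chord (cfrac_trunc R (exponents a) k)).
  by apply/funext => k; rewrite chordK// cfrac_trunc_ge0.
apply: continuous_cvg; [exact: unchord_continuous|exact: chord_cfrac_trunc_cvg].
Qed.

(** The inversion in [kappa (Sa) = - 1 / kappa a] is [r |-> 1 - r]. *)
Lemma kappa_word (s : bool) a : kappa R (word s a) =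
  if s then Rhat_opp (unchord (1 - coded R a)) else unchord (coded R a).
Proof.
rewrite /kappa starts_S_word digits_word cfrac_exponents.
by rewrite Rhat_inv_unchord// coded_ge0le1.
Qed.

Lemma kappa_V w : kappa R (farey_V w) = Rhat_opp (kappa R w).
Proof.
rewrite /farey_V /farey_S /farey_U !starts_S_word !digits_word.
rewrite -[w in RHS]wordK !kappa_word (coded_flip _ (digits w)).
by case: starts_S => /=; rewrite ?Rhat_oppK// subKr.
Qed.

Lemma kappa_S w : kappa R (farey_S w) = Rhat_opp (Rhat_inv (kappa R w)).
Proof.
rewrite /farey_S -[w in RHS]wordK !kappa_word.
have c01 := coded_ge0le1 R (digits w).
case: starts_S => /=; rewrite -Rhat_inv_unchord//.
by rewrite Rhat_invN Rhat_oppK Rhat_invK.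
Qed.

(** The point coded by the digits of the end above [x]: the coordinate of [x]
    if [x >= 0], and of [- 1 / x] if [x < 0], where the word starts with [S]. *)
Definition farey_coord x : R := if x < 0 then (1 - x)^-1 else x / (1 + x).

Lemma farey_coord_ge0le1 x : 0 <= farey_coord x <= 1.
Proof.
rewrite /farey_coord; case: ltP => x0; apply/andP; split.
- by rewrite invr_ge0; lra.
- by rewrite invf_le1; lra.
- by apply: divr_ge0; lra.
- by rewrite ler_pdivrMr; lra.
Qed.

Lemma farey_coord_irrational x : irrational x -> irrational (farey_coord x).
Proof.
move=> irr [q _ qE]; apply: irr.
exists (if x < 0 then 1 - q^-1 else q / (1 - q)) => //.
rewrite /farey_coord in qE; case: ltP qE => x0 qE.
  by rewrite rmorphB rmorph1 fmorphV /= qE invrK opprB addrC subrK.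
rewrite rmorphM fmorphV rmorphB rmorph1 /= qE; field.
by rewrite addrK oner_eq0 andbT; apply/eqP; lra.
Qed.

Lemma kappa_code x :
  kappa R (word (x < 0) (farey_code (farey_coord x))) = Some x.
Proof.
rewrite kappa_word coded_farey_code ?farey_coord_ge0le1// /farey_coord.
case: ltP => x0; rewrite /unchord ifF /=.
- congr Some; field; rewrite ?opprB ?addrA ?subrr.
  by apply/andP; split; apply/eqP; lra.
- apply/negbTE/eqP => /eqP; rewrite -subr_eq0 addrAC subrr add0r oppr_eq0.
  by rewrite invr_eq0 => /eqP; lra.
- by congr Some; field; rewrite addrK oner_eq0 andbT; apply/eqP; lra.
- apply/negbTE/eqP => /(congr1 ( *%R^~ (1 + x))) /=.
  by rewrite divfK; [|apply/eqP]; lra.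
Qed.

(** The digits of an end determine a value in [[0, oo]], so the sign of [x]
    tells whether the word starts with [S]; only 0 and infinity would be
    ambiguous. *)
Lemma kappa_irrational w x : irrational x -> kappa R w = Some x ->
  starts_S w = (x < 0) /\ coded R (digits w) = farey_coord x.
Proof.
move=> irr; have x0 : x != 0.
  by apply/eqP => E; apply: irr; exists 0; rewrite // rmorph0 E.
rewrite -[w]wordK kappa_word starts_S_word digits_word.
have := coded_ge0le1 R (digits w); move: (coded _ _) => c c01.
have c01' : 0 <= 1 - c <= 1 by lra.
rewrite /farey_coord; case: starts_S => E.
  have {}E : unchord (1 - c) = Some (- x) by rewrite -[LHS]Rhat_oppK E.
  have /= := unchord_ge0 c01'; rewrite E /= => xle.
  have xlt : x < 0 by move: x0; rewrite neq_lt => /orP[//|]; lra.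
  rewrite xlt; split=> //; apply/eqP.
  rewrite -(subKr 1 c) -[1 - c]unchordK// E /=.
  by apply/eqP; field; apply/eqP; lra.
have := unchord_ge0 c01; rewrite E /= => xge.
by rewrite ltNge xge; split => //; rewrite -[LHS]unchordK// E.
Qed.

Lemma kappa_inj w w' x : irrational x -> kappa R w = Some x ->
  kappa R w' = Some x -> w = w'.
Proof.
move=> irr /(kappa_irrational irr)[sw cw] /(kappa_irrational irr)[sw' cw'].
rewrite -[w]wordK -[w']wordK sw sw'; congr word; apply: (@coded_inj R).
  by rewrite cw; exact: farey_coord_irrational.
by rewrite cw cw'.
Qed.

(** [J_R] is defined through a choice of end, which is harmless by
    [kappa_inj]. *)
Lemma J_R_kappa x w : irrational x -> kappa R w = Some x ->
  J_R x = kappa R (farey_J w).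
Proof.
move=> irr wx; rewrite /J_R; congr (kappa _ (farey_J _)).
apply: (@xget_unique _ _ [set w | kappa R w = Some x]) => // w' w'x.
exact: kappa_inj w'x wx.
Qed.

End ContinuedFractions.

(** * Reduced words in the modular group *)

Definition gD (d : bool) : PSL2Z := if d then (gL ^+ 2)%g else gL.

Lemma word_edge_false a n :
  word_edge false a n.+1 = (gD (a 0%N) * word_edge true (tail a) n)%g.
Proof.
elim: n => [|n IH]; first by rewrite /= mul1g mulg1.
transitivity (word_edge false a n.+1 * word_letter false a n.+1)%g => //.
rewrite IH -mulgA; congr (_ * (_ * _))%g.
rewrite /word_letter addn1 addn0 subn0 /=; case: ifPn => // nn.
by case: n nn {IH} => [//|n] /negbNE nn; rewrite subn1 /=.
Qed.

(** [q] is meant to be a condition on the slope [x / y] of a vector [(x, y)],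
    and [slopes_in q g] asks it of the images of infinity and 0 under [g],
    i.e. of both ends of the edge of the Farey tessellation crossed by [g]. *)
Definition slopes_in (q : int -> int -> bool) (g : PSL2Z) : Prop :=
  exists M : SL2Z, [/\ g = (\pi_PSL2Z M)%qT, q (val M 0 0) (val M 1 0)
    & q (val M 0 1) (val M 1 1)].

(** The intervals of the ping-pong: slopes in [[-oo, 0]], [[0, oo]], [[1, oo]]
    and [[0, 1]].  All are quadratic conditions, hence insensitive to the sign
    of the matrix, and closed, hence satisfied by [1], [S] and [L], whose slopes
    are end points of the intervals. *)
Definition slope_le0 (x y : int) : bool := x * y <= 0.
Definition slope_ge0 (x y : int) : bool := 0 <= x * y.
Definition slope_ge1 (x y : int) : bool := 0 <= y * (x - y).
Definition slope_01 (x y : int) : bool := 0 <= x * (y - x).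
Definition slope_digit (d : bool) := if d then slope_01 else slope_ge1.

Lemma slopes_in_sub (q q' : int -> int -> bool) g :
  (forall x y, q x y -> q' x y) ->
  slopes_in q g -> slopes_in q' g.
Proof. by move=> qq' [M [-> q0 q1]]; exists M; split => //; exact: qq'. Qed.

Lemma lift01 : lift ord0 ord0 = 1 :> 'I_2.
Proof. exact/val_inj. Qed.

Lemma slopes_in_mul (q q' : int -> int -> bool) a b c d h g :
  (forall x y, q x y -> q' (a * x + b * y) (c * x + d * y)) ->
  slopes_in q g ->
  slopes_in q' ((\pi_PSL2Z (@mkSL2Z (mx2 a b c d) h))%qT * g)%g.
Proof.
move=> qq' [M [-> q0 q1]]; exists (SL2Z_mul (mkSL2Z h) M).
rewrite -Defs.pi_mul /=; split=> //;
  rewrite !mxE !big_ord_recl !big_ord0 !mxE /= !addr0 lift01; exact: qq'.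
Qed.

(** If two intervals have only one slope in common, then the columns of a matrix
    with slopes in both are proportional, against the determinant 1. *)
Lemma slopes_in_disjoint (q q' : int -> int -> bool) g :
  (forall x y, q (- x) (- y) = q x y) ->
  (forall x y z t, q x y -> q' x y -> q z t -> q' z t -> x * t - z * y != 1) ->
  slopes_in q g -> slopes_in q' g -> False.
Proof.
move=> qN qq' [M [-> q0 q1]] [N [/PSL2ZP MN q'0 q'1]].
have : \det (val N) == 1 := valP N.
rewrite (expand_det_row _ ord0) !big_ord_recl big_ord0 /cofactor !det_mx11 !mxE.
rewrite /= expr0 expr1 !mulNr !mul1r mulrN addr0.
rewrite ?lift01 (_ : lift 1 0 = ord0); last exact/val_inj.
apply/negP/qq' => //.
  by case/orP: MN q0 => /eqP ->; rewrite ?mxE ?qN.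
by case/orP: MN q1 => /eqP ->; rewrite ?mxE ?qN.
Qed.

Lemma slope_le0N x y : slope_le0 (- x) (- y) = slope_le0 x y.
Proof. by rewrite /slope_le0 mulrNN. Qed.

Lemma slope_ge1N x y : slope_ge1 (- x) (- y) = slope_ge1 x y.
Proof. by rewrite /slope_ge1 -opprD mulrNN. Qed.

Lemma slopes_one_le0 : slopes_in slope_le0 1%g.
Proof. by rewrite g1E; eexists; split; first by []; rewrite !mxE. Qed.

Lemma slopes_one_ge0 : slopes_in slope_ge0 1%g.
Proof. by rewrite g1E; eexists; split; first by []; rewrite !mxE. Qed.

Lemma slopes_S_le0 : slopes_in slope_le0 gS.
Proof. by eexists; split; first by []; rewrite !mxE. Qed.

(** [z |-> -1 / z] sends [[0, oo]] to [[-oo, 0]]. *)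
Lemma slopes_S g : slopes_in slope_ge0 g -> slopes_in slope_le0 (gS * g)%g.
Proof.
apply: slopes_in_mul => x y; rewrite /slope_ge0 /slope_le0 -oppr_ge0.
by congr (0 <= _); ring.
Qed.

(** [L] sends [[-oo, 0]] to [[1, oo]] and [L^2] sends it to [[0, 1]]. *)
Lemma slopes_gD d g : slopes_in slope_le0 g ->
  slopes_in (slope_digit d) (gD d * g)%g.
Proof.
case: d; rewrite /gD ?gL2E; apply: slopes_in_mul => x y;
  rewrite /slope_le0 /= /slope_ge1 /slope_01 -oppr_ge0;
  by congr (0 <= _); ring.
Qed.

Lemma slope_digit_ge0 d x y : slope_digit d x y -> slope_ge0 x y.
Proof. by case: d; rewrite /= /slope_ge0 /slope_01 /slope_ge1; nia. Qed.

Lemma slopes_word a n : slopes_in slope_le0 (word_edge true a n) /\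
  slopes_in slope_ge0 (word_edge false a n).
Proof.
elim: n a => [|n IH] a.
  by split; [exact: slopes_one_le0|exact: slopes_one_ge0].
split; first by rewrite word_edge_true; apply/slopes_S/(IH a).2.
rewrite word_edge_false; apply: slopes_in_sub (slopes_gD _ (IH (tail a)).1).
exact: slope_digit_ge0.
Qed.

Lemma slopes_word_false a n :
  slopes_in (slope_digit (a 0%N)) (word_edge false a n.+1).
Proof. by rewrite word_edge_false; apply/slopes_gD/(slopes_word _ _).1. Qed.

Lemma slope_le0_digit_disjoint d g :
  slopes_in slope_le0 g -> slopes_in (slope_digit d) g -> False.
Proof.
case: d; apply: slopes_in_disjoint; [exact: slope_le0N| |exact: slope_le0N|];
  move=> x y z t; rewrite /slope_le0 /= /slope_01 /slope_ge1 => h1 h2 h3 h4.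
  suff [-> ->] : x = 0 /\ z = 0 by rewrite !mul0r.
  split; nia.
suff [-> ->] : y = 0 /\ t = 0 by rewrite !mulr0.
split; nia.
Qed.

Lemma slope_digits_disjoint g :
  slopes_in slope_ge1 g -> slopes_in slope_01 g -> False.
Proof.
apply: slopes_in_disjoint; first exact: slope_ge1N.
move=> x y z t; rewrite /slope_01 /slope_ge1 => h1 h2 h3 h4.
suff [-> ->] : y = x /\ t = z by rewrite mulrC subrr.
split; nia.
Qed.

Lemma word_edge_false_neq_S a n : word_edge false a n.+1 <> gS.
Proof.
move=> E; apply: (@slope_le0_digit_disjoint (a 0%N) gS slopes_S_le0).
by rewrite -E; exact: slopes_word_false.
Qed.

Lemma word_edge_neq1 s a n : word_edge s a n.+1 <> 1%g.
Proof.
case: s; last first.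
  move=> E; apply: (@slope_le0_digit_disjoint (a 0%N) 1%g slopes_one_le0).
  by rewrite -E; exact: slopes_word_false.
rewrite word_edge_true => E; have {E} : word_edge false a n = gS.
  by apply: (mulgI gS); rewrite E -expg2 gS2.
case: n => [/= E|n]; last exact: word_edge_false_neq_S.
exact: (gS_neq1 (esym E)).
Qed.

(** Normal forms in [PSL_2(Z)]: the interval in which the slopes lie reveals the
    first letter, which can then be cancelled.  The words of length 0 need care,
    because [1] and [S] have the same two slopes, 0 and infinity. *)
Lemma word_edge_inj s a s' b n m : word_edge s a n = word_edge s' b m ->
  n = m /\ forall i, (i <= n)%N -> word_edge s a i = word_edge s' b i.
Proof.
have cross c d k l : word_edge true c k.+1 = word_edge false d l.+1 -> False.
  move=> E; apply: (slope_le0_digit_disjoint (slopes_word c k.+1).1).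
  by rewrite E; exact: slopes_word_false.
elim: n m s a s' b => [|n IH] [|m] s a s' b.
- by split=> // -[].
- by move=> /esym /word_edge_neq1.
- by move=> /word_edge_neq1.
case: s; case: s'; [|by move=> /cross|by move=> /esym/cross|]; last first.
  have [ab|ab] := eqVneq (a 0%N) (b 0%N).
    rewrite !word_edge_false ab => /mulgI/IH[-> ext]; split=> // -[//|i] lei.
    by rewrite !word_edge_false ab ext.
  have := slopes_word_false b m; have := slopes_word_false a n.
  move=> + + E; rewrite -E.
  by case: (a 0%N) (b 0%N) ab => -[] //= _ h1 h2;
    case: (slope_digits_disjoint (g := word_edge false a n.+1)).
rewrite !word_edge_true => /mulgI/IH[-> ext]; split=> // -[//|i] lei.
by rewrite !word_edge_true ext.
Qed.

Lemma edge_inj (w w' : farey_end) n m : edge w n = edge w' m ->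
  n = m /\ forall i, (i <= n)%N -> edge w i = edge w' i.
Proof. by rewrite -(wordK w) -(wordK w'); exact: word_edge_inj. Qed.

(** * Continuity of digitwise maps *)

Lemma ends_through_open g : open (ends_through g).
Proof.
exists [set ends_through g]; last by rewrite bigcup_set1.
move=> _ ->; exists [fset g]%fset; first by move=> h _; exact/mem_set.
by rewrite set_fset1 bigcap_set1.
Qed.

(** Digit [k] is the letter between the edges [2 k + s] and [2 k + s + 1], where
    [s] is the sign bit; [2 n + 2] edges thus show the digits up to [n]. *)
Lemma edge_agree_digits (w w' : farey_end) n :
  edge w n.*2.+2 = edge w' n.*2.+2 ->
  starts_S w = starts_S w' /\ forall k, (k <= n)%N -> digits w k = digits w' k.
Proof.
move=> /edge_inj[_ agree].
have sE : starts_S w = starts_S w'.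
  by rewrite /starts_S /letter !agree.
split=> // k kn; rewrite /digits -sE /letter !agree//.
  by case: (starts_S w); rewrite ?addn1 ?addn0; lia.
by case: (starts_S w); rewrite ?addn1 ?addn0; lia.
Qed.

Lemma word_edge_ext s a b n : (forall k, (k < n)%N -> a k = b k) ->
  word_edge s a n = word_edge s b n.
Proof.
elim: n => [//|n IH] ab /=; rewrite IH; last by move=> k kn; rewrite ab// ltnW.
by congr (_ * _)%g; rewrite /word_letter ab//; lia.
Qed.

(** Maps acting on the sign bit, and on each digit separately in a way that may
    depend on the sign bit and on the position. *)
Definition digitwise (p : bool -> bool) (q : bool -> nat -> bool -> bool)
  (w : farey_end) : farey_end :=
  word (p (starts_S w)) (fun k => q (starts_S w) k (digits w k)).

Lemma farey_continuous (f : farey_end -> farey_end) :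
  (forall w g, ends_through g (f w) -> nbhs w (f @^-1` ends_through g)) ->
  continuous f.
Proof.
move=> fP w U; rewrite nbhsE => -[V [[D sD <-] [B DB Bw]] VU].
have [A _ AB] := sD _ DB; rewrite -AB in Bw.
apply: (@filterS _ (nbhs w) _
  (\bigcap_(g in [set` A]) (f @^-1` ends_through g))).
  move=> w' Aw'; have Bw' : B (f w') by rewrite -AB => g /Aw'.
  by apply: VU; exists B.
by apply: filter_bigI => g gA; apply: fP; exact: Bw.
Qed.

Lemma digitwise_continuous p q : continuous (digitwise p q).
Proof.
apply: farey_continuous => w g [n <-].
apply: (@filterS _ (nbhs w) _ (ends_through (edge w n.*2.+2))); last first.
  by apply: open_nbhs_nbhs; split; [exact: ends_through_open|exists n.*2.+2].
move=> w' [m E]; have [mE _] := edge_inj E; rewrite mE in E.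
have [sE dE] := edge_agree_digits E.
exists n; rewrite /digitwise /= sE; apply: word_edge_ext => k kn.
by rewrite dE// ltnW.
Qed.

Lemma farey_SE : farey_S = digitwise negb (fun _ _ d => d).
Proof. by []. Qed.

Lemma farey_JE : farey_J = digitwise id (fun s k d => d (+) (s (+) odd k)).
Proof.
apply/funext => w; rewrite /farey_J /digitwise /phi /phi_star.
by case: starts_S => //=; congr word; apply/funext => k; rewrite addTb.
Qed.

Lemma farey_SK : involutive farey_S.
Proof.
by move=> w; rewrite /farey_S starts_S_word digits_word negbK wordK.
Qed.

Lemma farey_JK : involutive farey_J.
Proof.
move=> w; rewrite farey_JE /digitwise starts_S_word digits_word -[RHS]wordK.
by congr word; apply/funext => k; rewrite addbK.
Qed.

Lemma homeomorphism_involution (X : topologicalType) (f : X -> X) :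
  continuous f -> involutive f -> homeomorphism f.
Proof. by move=> fc fK; split=> //; exists f. Qed.

(** Changing the sign bit exchanges [phi] and [phi_star], which are negations of
    each other. *)
Lemma farey_J_S : farey_J \o farey_S = farey_V \o farey_J.
Proof.
apply/funext => w /=; rewrite farey_JE /farey_V /farey_U /farey_S /digitwise.
rewrite !starts_S_word !digits_word; congr word; apply/funext => k.
by rewrite addNb !addbN.
Qed.

(** * Equivariance of J under S *)

Theorem lemma10 (R : realType) :
  [/\ homeomorphism farey_J,
      homeomorphism farey_S,
      farey_J \o farey_S = farey_V \o farey_J
    & forall x : R, irrational x -> J_R (-1 / x) = Rhat_opp (J_R x)].
Proof.
split.
- apply: homeomorphism_involution farey_JK.
  by rewrite farey_JE; exact: digitwise_continuous.
- apply: homeomorphism_involution farey_SK.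
  by rewrite farey_SE; exact: digitwise_continuous.
- exact: farey_J_S.
move=> x irr; have x0 : x != 0.
  by apply/eqP => x0; apply: irr; exists 0; rewrite // rmorph0 x0.
have irrV : irrational (-1 / x).
  move=> [q _ qE]; apply: irr; exists (- q^-1) => //.
  by rewrite rmorphN fmorphV /= qE mulN1r invrN invrK opprK.
have wx := kappa_code x; move: (word _ _) wx => w wx.
have Swx : kappa R (farey_S w) = Some (-1 / x).
  by rewrite kappa_S wx /= (negPf x0) /= mulN1r.
rewrite (J_R_kappa irrV Swx) (J_R_kappa irr wx) -kappa_V.
by rewrite -[farey_J _]/((farey_J \o farey_S) w) farey_J_S.
Qed.
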